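(* Let $N=n^2$ and let $\bm{y}\in\mathbb{R}^{N}$ be the vectorized observations of a directed network on $n$ nodes, indexed by ordered pairs $(i,j)$, $1\le i,j\le n$. Let $\bm{X}$ be a fixed $N\times p$ covariate matrix of full column rank, $\bm{P}_X=\bm{X}(\bm{X}^\top\bm{X})^{-1}\bm{X}^\top$, and let $\bm{A},\bm{B}$ be the $N\times n$ sender and receiver incidence matrices (the row of $\bm{A}$ for pair $(i,j)$ is the $i$-th standard basis vector of $\mathbb{R}^n$, and the row of $\bm{B}$ for pair $(i,j)$ is the $j$-th standard basis vector). Consider the continuous Restricted Network Regression model $$\bm{y}=\bm{X}\bm{\delta}+(\bm{I}-\bm{P}_X)\bm{A}\bm{a}+(\bm{I}-\bm{P}_X)\bm{B}\bm{b}+\bm{\varepsilon},$$ with flat prior $p(\bm{\delta})\propto 1$, $\bm{a}\sim N(\bm{0},\sigma_a^2\bm{I}_n)$, $\bm{b}\sim N(\bm{0},\sigma_b^2\bm{I}_n)$, $\bm{\varepsilon}\sim N(\bm{0},\sigma_\varepsilon^2\bm{I}_N)$, all mutually independent given the variance parameters, and any prior on $(\sigma_a^2,\sigma_b^2,\sigma_\varepsilon^2)$ (independent of $\bm\delta$) for which the joint posterior is proper and $\mathrm{E}[\sigma^2_\varepsilon\mid\bm{y}]<\infty$. Then the posterior distribution of $\bm{\delta}$ satisfies $$\mathrm{E}[\bm{\delta}\mid\bm{y}]=(\bm{X}^\top\bm{X})^{-1}\bm{X}^\top\bm{y},\qquad \mathrm{Var}(\bm{\delta}\mid\bm{y})=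(\bm{X}^\top\bm{X})^{-1}\,\mathrm{E}[\sigma^2_\varepsilon\mid\bm{y}].$$
   Context: $\bm{I}-\bm{P}_X$ is the orthogonal projection onto the orthogonal complement of the column space of $\bm{X}$; the random effects $\bm a$ (sender) and $\bm b$ (receiver) are thus projected to be orthogonal to the covariates. The parameters $\bm\delta$ are interpreted as unconditional regression effects. *)

(* Defs.v *)
From HB Require Import structures.
From mathcomp Require Import all_boot all_order all_algebra.
From mathcomp Require Import all_classical all_reals all_analysis.
Set Implicit Arguments. Unset Strict Implicit. Unset Printing Implicit Defensive.
Import Order.TTheory GRing.Theory Num.Theory.
Local Open Scope ring_scope.
Local Open Scope classical_set_scope.

Section Defs.
Variable R : realType.

(* Lebesgue integral over R^k of a (nonnegative) function, as the iterated
   one-dimensional Lebesgue integral (equal to the k-dimensional Lebesgue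
   integral for nonnegative measurable functions, by Tonelli). *)
Fixpoint lint (k : nat) : ('rV[R]_k -> \bar R) -> \bar R :=
  match k with
  | 0 => fun f => f 0
  | k'.+1 => fun f =>
      (\int[@lebesgue_measure R]_(x in setT)
         lint (fun v : 'rV[R]_k' => f (row_mx (\row_(i < 1) x) v)))%E
  end.

Definition gauss (v x : R) : R :=
  (Num.sqrt (2 * pi * v))^-1 * expR (- (x ^+ 2) / (2 * v)).

Definition projX (N p : nat) (X : 'M[R]_(N, p)) : 'M[R]_N :=
  X *m invmx (X^T *m X) *m X^T.

(* observations indexed by k : 'I_(n*n), pair (i,j) <-> k = i*n + j *)
Definition sender_mx (n : nat) : 'M[R]_(n * n, n) :=
  \matrix_(k < n * n, l < n) ((k %/ n)%N == l)%:R.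
Definition receiver_mx (n : nat) : 'M[R]_(n * n, n) :=
  \matrix_(k < n * n, l < n) ((k %% n)%N == l)%:R.

Definition th_delta n p (th : 'rV[R]_(p + (n + n))) : 'rV[R]_p := lsubmx th.
Definition th_a n p (th : 'rV[R]_(p + (n + n))) : 'rV[R]_n := lsubmx (rsubmx th).
Definition th_b n p (th : 'rV[R]_(p + (n + n))) : 'rV[R]_n := rsubmx (rsubmx th).

(* variance parameters s = (sigma_a^2, sigma_b^2, sigma_eps^2) *)
Definition s_a (s : R * R * R) := s.1.1.
Definition s_b (s : R * R * R) := s.1.2.
Definition s_e (s : R * R * R) := s.2.

(* unnormalized joint posterior density of (delta, a, b) given s, w.r.t.
   Lebesgue measure; flat prior on delta, N(0, s_a I) on a, N(0, s_b I)
   on b, and likelihood y ~ N(X delta + (I-P)A a + (I-P)B b, s_e I). *)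
Definition rnr_dens n p (X : 'M[R]_(n * n, p)) (y : 'cV[R]_(n * n))
  (s : R * R * R) (th : 'rV[R]_(p + (n + n))) : R :=
  let Q := 1%:M - projX X in
  let mu := X *m (th_delta th)^T + Q *m sender_mx n *m (th_a th)^T
            + Q *m receiver_mx n *m (th_b th)^T in
  (\prod_(i < n) gauss (s_a s) (th_a th 0 i)) *
  (\prod_(i < n) gauss (s_b s) (th_b th 0 i)) *
  (\prod_(k < n * n) gauss (s_e s) (y k 0 - mu k 0)).

(* integral of g against the unnormalized joint posterior:
   nu is the prior on the variance parameters *)
Definition post_int n p (X : 'M[R]_(n * n, p)) (y : 'cV[R]_(n * n))
  (nu : {measure set (R * R * R)%type -> \bar R})
  (g : R * R * R -> 'rV[R]_(p + (n + n)) -> R) : \bar R :=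
  (\int[nu]_(s in setT) lint (fun th => (g s th * rnr_dens X y s th)%:E))%E.

Definition pos_part (T U : Type) (g : T -> U -> R) := fun t u => Num.max (g t u) 0.
Definition neg_part (T U : Type) (g : T -> U -> R) := fun t u => Num.max (- g t u) 0.

Definition post_Z n p X y nu := @post_int n p X y nu (fun _ _ => 1).

Definition post_integrable n p X y nu g :=
  (@post_int n p X y nu (pos_part g) < +oo /\ @post_int n p X y nu (neg_part g) < +oo)%E.

Definition postE n p X y nu g : R :=
  (fine (@post_int n p X y nu (pos_part g)) - fine (@post_int n p X y nu (neg_part g)))
  / fine (@post_Z n p X y nu).

End Defs.

(* Main.v *)
Require Import Defs.
From HB Require Import structures.
From mathcomp Require Import all_boot all_order all_algebra.
From mathcomp Require Import all_classical all_reals all_analysis.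
From mathcomp Require Import measurable_realfun.
From mathcomp Require Import ring lra.
Import Order.TTheory GRing.Theory Num.Theory.
Import numFieldNormedType.Exports.
Local Open Scope ring_scope.
Local Open Scope classical_set_scope.

(** Completing the square makes the joint density [D] behave simply under a
    shift of [delta]: since the random effects are projected orthogonally to
    the columns of [X], for [x := c . (delta - bhat)],
    [D (delta - t s M^-1 c) = exp (t x - t^2 s k / 2) D delta], where
    [s = sigma_eps^2], [M = X^T X] and [k = c^T M^-1 c].  Lebesgue measure is
    translation invariant, so every exponential moment of [x] is known relative
    to the normalising constant [Z s], and letting [t] tend to [0] gives
    [int x D = 0] and [int x^2 D = s k Z s].  Neither the value of [Z s] nor
    the law of the random effects enters.  Polarisation in [c] and integration
    over the prior of the variances conclude. *)

(** * Translation invariance and measurability on the real line *)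

Lemma lebesgue_measure_translation (R : realType) (w : R) (A : set R) :
  measurable A ->
  pushforward (@lebesgue_measure R)
    (fun x : measurableTypeR R => x + w : measurableTypeR R) A =
  lebesgue_measure A.
Proof.
move=> mA; apply/esym/lebesgue_measure_unique => //=.
  by apply: measurable_funD => //; exact: measurable_cst.
(* Uniqueness of Lebesgue measure leaves only half-open intervals to check, and a shift preserves
   their length. *)
move=> mphi _ [[a b]] _ <- /=; rewrite /pushforward.
have -> : (fun x : measurableTypeR R => x + w : measurableTypeR R) @^-1`
    `]a, b] = `]a - w, b - w]%classic.
  by apply/seteqP; split => x /=; rewrite !in_itv/=; lra.
rewrite !lebesgue_measure_itv/= !lte_fin ltrD2r.
by case: ifP => // _; rewrite -!EFinD; congr EFin; ring.
Qed.

Lemma ge0_integral_translation (R : realType) (f : R -> \bar R) (w : R) :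
  measurable_fun [set: R] f -> (forall x, 0 <= f x)%E ->
  (\int[@lebesgue_measure R]_x f (x + w)%R = \int[@lebesgue_measure R]_x f x)%E.
Proof.
move=> mf f0.
have mphi : measurable_fun [set: measurableTypeR R]
    (fun x : measurableTypeR R => x + w : measurableTypeR R).
  by apply: measurable_funD => //; exact: measurable_cst.
have := @ge0_integral_pushforward _ _ _ _ R _ mphi (@lebesgue_measure R) setT
  f measurableT mf.
rewrite preimage_setT => <-; last by move=> ? _; exact: f0.
apply: eq_measure_integral => A mA _; exact: lebesgue_measure_translation.
Qed.

(** Inversion is continuous only off [0], so the point [0] is split off as a measurable
    singleton. *)
Lemma measurable_invr (R : realType) : measurable_fun [set: R] (@GRing.inv R).
Proof.
have -> : [set: R] = [set 0] `|` [set~ 0] by rewrite setUCr.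
apply/measurable_funU => //; first exact: measurableC.
split; first exact: measurable_fun_set1.
apply: open_continuous_measurable_fun => [|x].
  by apply: closed_openC; exact: closed_eq.
by rewrite inE /= => /eqP x0; exact: inv_continuous.
Qed.

Lemma measurable_sqrtr (R : realType) :
  measurable_fun [set: R] (@Num.sqrt R).
Proof. by apply: continuous_measurable_fun; exact: sqrt_continuous. Qed.

(** * The iterated integral: measurability, linearity, monotonicity, translation *)

Section Lint.
Set Implicit Arguments.
Unset Strict Implicit.
Variable R : realType.

Definition measurable_rV d (T : measurableType d) k (v : T -> 'rV[R]_k) :=
  forall i, measurable_fun [set: T] (fun x => v x 0 i).

(* Joint measurability on [T * R^k], expressed through measurable plots because
   ['rV[R]_k] carries no sigma-algebra. *)
Definition jmeasurable d (T : measurableType d) d' (U : measurableType d') k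
    (F : T -> 'rV[R]_k -> U) :=
  forall d1 (T1 : measurableType d1) (t : T1 -> T) (v : T1 -> 'rV[R]_k),
    measurable_fun [set: T1] t -> measurable_rV v ->
    measurable_fun [set: T1] (fun x => F (t x) (v x)).

Definition rV_cons k (x : R) (v : 'rV[R]_k) : 'rV[R]_k.+1 :=
  row_mx (\row_(i < 1) x) v.

Lemma lintS k (f : 'rV[R]_k.+1 -> \bar R) :
  lint f = (\int[@lebesgue_measure R]_x lint (fun v => f (rV_cons x v)))%E.
Proof. by []. Qed.

Lemma measurable_rV_cons d (T : measurableType d) k (x : T -> R)
    (v : T -> 'rV[R]_k) :
  measurable_fun [set: T] x -> measurable_rV v ->
  measurable_rV (fun t => rV_cons (x t) (v t)).
Proof.
move=> mx mv i; rewrite /rV_cons.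
case: (@split_ordP 1 k i) => j ->.
  rewrite (_ : (fun _ => _) = x)//; apply/funext => t.
  by apply: etrans (row_mxEl _ _ _ _) _; rewrite mxE.
rewrite (_ : (fun _ => _) = (fun t => v t 0 j)) //.
by apply/funext => t; exact: row_mxEr.
Qed.

(** Moves the first coordinate into the parameter space, which is what makes inductions on the
    dimension go through. *)
Lemma jmeasurable_cons d (T : measurableType d) k
    (F : T -> 'rV[R]_k.+1 -> \bar R) :
  jmeasurable F ->
  jmeasurable (fun (tx : T * R) v => F tx.1 (rV_cons tx.2 v)).
Proof.
move=> mF d1 T1 t v mt mv; apply: mF.
  exact: measurableT_comp.
by apply: measurable_rV_cons => //; exact: measurableT_comp.
Qed.

Lemma jmeasurable_slice d (T : measurableType d) d' (U : measurableType d') k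
    (F : T -> 'rV[R]_k -> U) d2 (T2 : measurableType d2) (t : T) :
  jmeasurable F -> jmeasurable (fun _ : T2 => F t).
Proof. by move=> mF d1 T1 u v mu mv; apply: mF => //; exact: measurable_cst. Qed.

Lemma lint_ge0 k (f : 'rV[R]_k -> \bar R) :
  (forall v, 0 <= f v)%E -> (0 <= lint f)%E.
Proof.
elim: k f => [|k IH] f f0 /=; first exact: f0.
by apply: integral_ge0 => x _; apply: IH.
Qed.

(** Induction on [k] with the parameter space [T] generalised: the first coordinate joins [T], and
    Tonelli on [T * R] then integrates it out. *)
Lemma measurable_lint d (T : measurableType d) k
    (F : T -> 'rV[R]_k -> \bar R) :
  jmeasurable F -> (forall t v, 0 <= F t v)%E ->
  measurable_fun [set: T] (fun t => lint (F t)).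
Proof.
elim: k d T F => [|k IH] d T F mF F0 /=.
  apply: mF => // i; exact: measurable_cst.
have mG := IH _ _ _ (jmeasurable_cons mF) (fun tx v => F0 _ _).
exact: (measurable_fun_fubini_tonelli_F (m2 := @lebesgue_measure R)
  (fun tx : T * R => lint (fun v => F tx.1 (rV_cons tx.2 v)))
  mG (fun tx => lint_ge0 (fun v => F0 _ _))).
Qed.

(** The trivial parameter space [unit] gives measurability in the vector alone. *)
Definition rV_measurable k (f : 'rV[R]_k -> \bar R) :=
  jmeasurable (fun _ : unit => f).

Lemma rV_measurable_cons k (f : 'rV[R]_k.+1 -> \bar R) x :
  rV_measurable f -> rV_measurable (fun v => f (rV_cons x v)).
Proof.
move=> mf d1 T1 t v mt mv; apply: (mf _ _ (fun=> tt)) => //.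
by apply: measurable_rV_cons => //; exact: measurable_cst.
Qed.

Lemma measurable_lint_cons k (f : 'rV[R]_k.+1 -> \bar R) :
  rV_measurable f -> (forall v, 0 <= f v)%E ->
  measurable_fun [set: R] (fun x => lint (fun v => f (rV_cons x v))).
Proof.
move=> mf f0; apply: (@measurable_lint _ R _ (fun x v => f (rV_cons x v))) => //.
move=> d1 T1 t v mt mv; apply: (mf _ _ (fun=> tt)) => //.
exact: measurable_rV_cons.
Qed.

Lemma lintD k (f g : 'rV[R]_k -> \bar R) :
  rV_measurable f -> rV_measurable g ->
  (forall v, 0 <= f v)%E -> (forall v, 0 <= g v)%E ->
  (lint (fun v => f v + g v) = lint f + lint g)%E.
Proof.
elim: k f g => [//|k IH] f g mf mg f0 g0; rewrite !lintS.
rewrite -ge0_integralD//.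
- apply: eq_integral => x _.
  by rewrite -IH //; exact: rV_measurable_cons.
- by move=> x _; exact: lint_ge0.
- exact: measurable_lint_cons.
- by move=> x _; exact: lint_ge0.
- exact: measurable_lint_cons.
Qed.

Lemma lintZ k (r : R) (f : 'rV[R]_k -> \bar R) :
  rV_measurable f -> (forall v, 0 <= f v)%E -> 0 <= r ->
  (lint (fun v => r%:E * f v) = r%:E * lint f)%E.
Proof.
elim: k f => [//|k IH] f mf f0 r0; rewrite !lintS.
rewrite -ge0_integralZl_EFin//.
- apply: eq_integral => x _.
  by rewrite -IH //; exact: rV_measurable_cons.
- by move=> x _; exact: lint_ge0.
- exact: measurable_lint_cons.
Qed.

Lemma le_lint k (f g : 'rV[R]_k -> \bar R) :
  rV_measurable f -> rV_measurable g ->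
  (forall v, 0 <= f v)%E -> (forall v, f v <= g v)%E ->
  (lint f <= lint g)%E.
Proof.
elim: k f g => [|k IH] f g mf mg f0 fg; first exact: fg.
rewrite !lintS; have g0 v : (0 <= g v)%E by exact: le_trans (fg v).
apply: ge0_le_integral => //.
- by move=> x _; exact: lint_ge0.
- exact: measurable_lint_cons.
- exact: measurable_lint_cons.
- move=> x _; apply: IH => //; exact: rV_measurable_cons.
Qed.

(** The outer integral absorbs the first coordinate of [w] by invariance on the line; the induction
    hypothesis absorbs the remaining ones. *)
Lemma lint_translation k (f : 'rV[R]_k -> \bar R) (w : 'rV[R]_k) :
  rV_measurable f -> (forall v, 0 <= f v)%E ->
  lint (fun v => f (v + w)) = lint f.
Proof.
elim: k f w => [|k IH] f w mf f0; first by rewrite /= (thinmx0 w) addr0.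
pose w1 := @lsubmx _ 1 1 k w 0 0; pose w2 := @rsubmx _ 1 1 k w.
have wE : w = rV_cons w1 w2.
  rewrite -[LHS](@hsubmxK _ 1 1 k w); congr (@row_mx _ 1 1 k _ _).
  by apply/rowP => i; rewrite [RHS]mxE ord1.
have consD x v : rV_cons x v + w = rV_cons (x + w1) (v + w2).
  rewrite [in LHS]wE; apply: etrans (@add_row_mx _ 1 1 k _ _ _ _) _.
  congr (@row_mx _ 1 1 k _ _).
  by apply/rowP => i; rewrite !mxE.
rewrite !lintS.
rewrite -(ge0_integral_translation _ _ w1 (measurable_lint_cons mf f0)); last first.
  by move=> x; exact: lint_ge0.
apply: eq_integral => x _; rewrite -[RHS](IH _ w2) //.
  by congr lint; apply/funext => v; rewrite consD.
exact: rV_measurable_cons.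
Qed.

End Lint.

(** * Exponential inequalities and a substitute for limits *)

Section Hyperbolic.
Set Implicit Arguments.
Unset Strict Implicit.
Context {R : realType}.
Implicit Types x y : R.

Lemma nonneg_derive_ge0 (f f' : R -> R) :
  (forall x, is_derive x 1 f (f' x)) -> f 0 = 0 ->
  (forall x, 0 <= x -> 0 <= f' x) -> forall x, 0 <= x -> 0 <= f x.
Proof.
move=> df f0 f'0 x x0.
have cf : {within `[0, x], continuous f}.
  apply: continuous_subspaceT => y.
  by apply: differentiable_continuous; apply/derivable1_diffP; case: (df y).
have := @ger0_derive1_le_cc R f 0 x _ _ cf 0 x.
rewrite f0; apply; rewrite ?in_itv/= ?lexx ?x0//.
move=> y; rewrite in_itv/= => /andP[/ltW y0 _].
by rewrite derive1E (@derive_val _ _ _ _ _ _ _ (df y)) f'0.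
Qed.

(** Arithmetic-geometric mean inequality for two positive numbers of product [1]. *)
Lemma expR_add_expRN_ge2 x : 2 <= expR x + expR (- x).
Proof.
have := expRxMexpNx_1 x; have := sqr_ge0 (expR x - expR (- x)).
have := expR_gt0 x; have := expR_gt0 (- x); nra.
Qed.

Lemma expR_sub_expRN_ge y : 0 <= y -> 2 * y <= expR y - expR (- y).
Proof.
move=> y0; rewrite -subr_ge0; move: y y0.
apply: (@nonneg_derive_ge0 (fun y => expR y - expR (- y) - 2 * y)
  (fun y => expR y + expR (- y) - 2)).
- move=> x; apply: is_derive_eq; rewrite /GRing.scale /=; ring.
- by rewrite oppr0 expR0; ring.
- by move=> x _; rewrite subr_ge0 expR_add_expRN_ge2.
Qed.

(** This is [tanh y <= y] with denominators cleared; the derivative of the difference is [y] times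
    [expR y - expR (- y)]. *)
Lemma expR_sub_expRN_le y : 0 <= y ->
  expR y - expR (- y) <= y * (expR y + expR (- y)).
Proof.
move=> y0; rewrite -subr_ge0; move: y y0.
apply: (@nonneg_derive_ge0
  (fun y => y * (expR y + expR (- y)) - (expR y - expR (- y)))
  (fun y => y * (expR y - expR (- y)))).
- move=> x; apply: is_derive_eq; rewrite /GRing.scale /=; ring.
- by rewrite oppr0 expR0; ring.
- by move=> x x0; rewrite mulr_ge0// subr_ge0 ler_expR; lra.
Qed.

(* [cosh x - 1 = 2 sinh^2 (x / 2)] reduces both bounds on [cosh] to [sinh]. *)
Lemma expR_half x :
  expR x + expR (- x) - 2 = (expR (x / 2) - expR (- (x / 2))) ^+ 2.
Proof.
have -> : expR x = expR (x / 2) ^+ 2 by rewrite expr2 -expRD; congr expR; field.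
have -> : expR (- x) = expR (- (x / 2)) ^+ 2.
  by rewrite expr2 -expRD; congr expR; field.
have := expRxMexpNx_1 (x / 2); set a := expR _; set b := expR _ => h.
by rewrite sqrrB h; ring.
Qed.

Lemma cosh_ge x : 2 + x ^+ 2 <= expR x + expR (- x).
Proof.
wlog x0 : x / 0 <= x => [H|].
  have [/H//|/ltW xn] := leP 0 x.
  by have := H (- x); rewrite sqrrN opprK oppr_ge0 [expR _ + _]addrC; apply.
have h : 0 <= x / 2 by lra.
have := expR_sub_expRN_ge h; have := expR_half x; nra.
Qed.

(** Write [C] for [expR x + expR (- x)]. Squaring [tanh (x / 2) <= x / 2] gives
    [C - 2 <= x^2 / 4 * (C + 2)], and [2 <= C] finishes. The factor [C] on the right is harmless
    later, because exponential tilts of [x^2] can be integrated. *)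
Lemma cosh_le x :
  expR x + expR (- x) <= 2 + x ^+ 2 / 2 * (expR x + expR (- x)).
Proof.
wlog x0 : x / 0 <= x => [H|].
  have [/H//|/ltW xn] := leP 0 x.
  by have := H (- x); rewrite sqrrN opprK oppr_ge0 [expR _ + _]addrC; apply.
have h : 0 <= x / 2 by lra.
have := expR_sub_expRN_le h; have := expR_sub_expRN_ge h.
have := expR_half x; have := expR_add_expRN_ge2 x.
have e1 := expRxMexpNx_1 (x / 2).
set a := expR (x / 2) in e1 *; set b := expR (- (x / 2)) in e1 *.
set C := expR x + expR (- x) => C2 CE sge sle.
have cc : (a + b) ^+ 2 = C + 2.
  have -> : C = C - 2 + 2 by ring.
  by rewrite CE sqrrD sqrrB e1; ring.
have s2 : (a - b) ^+ 2 <= (x / 2 * (a + b)) ^+ 2.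
  by rewrite ler_pXn2r ?nnegrE//; lra.
rewrite exprMn cc -CE in s2.
have : x ^+ 2 / 4 * (C + 2) <= x ^+ 2 / 4 * (C + C).
  by rewrite ler_wpM2l ?lerD2l// divr_ge0// sqr_ge0.
rewrite (_ : (x / 2) ^+ 2 = x ^+ 2 / 4) in s2; last by field.
lra.
Qed.

(** Replaces the passage [t -> 0+], so that no limit of integrals has to be taken. *)
Lemma le_of_slope (A B C : R) :
  (forall t : R, 0 < t -> t <= 1 -> A <= B + t * C) -> A <= B.
Proof.
move=> H; rewrite leNgt; apply/negP => AB.
(* The case [t = 1] yields [A - B <= C], so [C] is positive and the witness [(A - B) / (2 * C)] is
   at most [1]; it makes the error term half of the gap [A - B]. *)
have h1 := H 1 ltr01 (lexx 1); rewrite mul1r in h1.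
have C0 : 0 < C by lra.
have t0 : 0 < (A - B) / (2 * C) by rewrite divr_gt0//; lra.
have t1 : (A - B) / (2 * C) <= 1 by rewrite ler_pdivrMr; lra.
have := H _ t0 t1.
have -> : (A - B) / (2 * C) * C = (A - B) / 2 by field; lra.
lra.
Qed.

(** Multiplying [1 - a <= expR (- a)] by [expR a] gives [expR a <= 1 + a * expR a]. *)
Lemma expR_le_affine (a b : R) : 0 <= a <= b -> expR a <= 1 + a * expR b.
Proof.
move=> /andP[a0 ab].
have h : expR a * (1 - a) <= 1.
  rewrite -[X in _ <= X](expRxMexpNx_1 a) ler_wpM2l ?expR_ge0//.
  exact: expR_ge1Dx.
have : a * expR a <= a * expR b by rewrite ler_wpM2l// ler_expR.
lra.
Qed.
End Hyperbolic.

(** * First two moments from the exponential tilt identity *)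

Section TiltedMoments.
Set Implicit Arguments.
Unset Strict Implicit.
Context {R : realType}.

Definition nnmeas (phi : R -> R) :=
  measurable_fun [set: R] phi /\ forall x, 0 <= phi x.

(** [I phi] abstracts the integral of [phi] of a linear statistic against the density at fixed
    variances. Here [z] is the total mass and [sg] the expected variance. *)
Variables (I : (R -> R) -> \bar R) (sg z : R).
Hypothesis I_add : forall f g, nnmeas f -> nnmeas g ->
  (I (fun x => (f x + g x)%R) = I f + I g)%E.
Hypothesis I_scale : forall (r : R) f, 0 <= r -> nnmeas f ->
  (I (fun x => (r * f x)%R) = r%:E * I f)%E.
Hypothesis I_le : forall f g, nnmeas f -> nnmeas g -> (forall x, f x <= g x) ->
  (I f <= I g)%E.
Hypothesis I_ge0 : forall f, nnmeas f -> (0 <= I f)%E.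
Hypothesis I_one : I (fun=> 1) = z%:E.
Hypothesis sg_ge0 : 0 <= sg.
(** Tilting by [expR (t * x)] shifts the law by [t * sg], up to a scalar factor: the behaviour of a
    centred Gaussian of variance [sg]. *)
Hypothesis tilt : forall t f, nnmeas f ->
  (I (fun x => (f x * expR (t * x))%R) =
   (expR (t ^+ 2 * sg / 2))%:E * I (fun x => f (x + t * sg)%R))%E.

(** The Gaussian moment generating function. *)
Let E (t : R) := expR (t ^+ 2 * sg / 2).

Lemma nnmeas_cst (r : R) : 0 <= r -> nnmeas (fun=> r).
Proof. by move=> r0; split => //; exact: measurable_cst. Qed.

Lemma nnmeas_exp (t : R) : nnmeas (fun x : R => expR (t * x)).
Proof.
split=> [|x]; last exact: expR_ge0.
apply: measurableT_comp => //; apply: measurable_funM => //.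
Qed.

Lemma nnmeas_sqr (h : R) : nnmeas (fun x => (x + h) ^+ 2).
Proof.
split=> [|x]; last exact: sqr_ge0.
apply: measurable_funX; exact: measurable_funD.
Qed.

Lemma nnmeas_sqr0 : nnmeas (fun x => x ^+ 2).
Proof. by split=> [|x]; [exact: measurable_funX|exact: sqr_ge0]. Qed.

Lemma nnmeas_add f g : nnmeas f -> nnmeas g -> nnmeas (fun x => f x + g x).
Proof.
by move=> [mf f0] [mg g0]; split=> [|x]; [exact: measurable_funD|exact: addr_ge0].
Qed.

Lemma nnmeas_mul f g : nnmeas f -> nnmeas g -> nnmeas (fun x => f x * g x).
Proof.
by move=> [mf f0] [mg g0]; split=> [|x]; [exact: measurable_funM|exact: mulr_ge0].
Qed.

Lemma nnmeas_scale (r : R) f : 0 <= r -> nnmeas f -> nnmeas (fun x => r * f x).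
Proof. by move=> r0; apply: nnmeas_mul; exact: nnmeas_cst. Qed.

Lemma nnmeas_pos : nnmeas (fun x => Num.max x 0).
Proof.
split=> [|x]; last by rewrite le_max lexx orbT.
by apply: measurable_maxr => //; exact: measurable_cst.
Qed.

Lemma nnmeas_neg : nnmeas (fun x => Num.max (- x) 0).
Proof.
split=> [|x]; last by rewrite le_max lexx orbT.
by apply: measurable_maxr; [exact: measurable_funN|exact: measurable_cst].
Qed.

Hint Resolve nnmeas_cst nnmeas_exp nnmeas_sqr nnmeas_sqr0 nnmeas_add nnmeas_mul
  nnmeas_scale nnmeas_pos nnmeas_neg ler01 ler0n : core.

Let I_exp t : I (fun x => expR (t * x)) = (E t * z)%:E.
Proof.
have := tilt t (nnmeas_cst ler01); rewrite I_one -EFinM => <-.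
by congr I; apply/funext => x; rewrite mul1r.
Qed.

Let I_cosh t : I (fun x => expR (t * x) + expR (- t * x)) = (2 * E t * z)%:E.
Proof.
rewrite I_add// !I_exp -EFinD; congr EFin; rewrite /E sqrrN; ring.
Qed.

Let I_fin f r : nnmeas f -> (I f <= r%:E)%E -> exists2 q : R, 0 <= q & I f = q%:E.
Proof.
move=> nf; have := I_ge0 nf; case: (I f) => [q q0 _|_|//]; last by rewrite leye_eq.
by exists q; rewrite -?lee_fin.
Qed.

Let z_ge0 : 0 <= z.
Proof. by have := I_ge0 (nnmeas_cst ler01); rewrite I_one lee_fin. Qed.

Let E_ge t : 1 + t ^+ 2 * sg / 2 <= E t.
Proof. exact: expR_ge1Dx. Qed.

(** The constant that [expR_le_affine] yields for exponents in [[0, sg / 2]], the range of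
    [t ^+ 2 * sg / 2] for [t] in [[0, 1]]. *)
Let K := sg / 2 * expR (sg / 2).

Let K_ge0 : 0 <= K.
Proof. by rewrite mulr_ge0 ?expR_ge0 ?divr_ge0. Qed.

Let E_le (t : R) : 0 < t -> t <= 1 -> E t <= 1 + t ^+ 2 * K.
Proof.
move=> t0 t1.
have t2 : t ^+ 2 <= 1 by rewrite expr_le1// ltW.
have /expR_le_affine : 0 <= t ^+ 2 * sg / 2 <= sg / 2.
  have ts : t ^+ 2 * sg <= sg by rewrite ler_piMl.
  by have := mulr_ge0 (sqr_ge0 t) sg_ge0; lra.
by rewrite -/(E t) /K -!mulrA.
Qed.

Let E_le1 (t : R) : 0 < t -> t <= 1 -> E t <= 1 + t * K.
Proof.
move=> t0 t1; apply: (le_trans (E_le t0 t1)); rewrite lerD2l ler_wpM2r//; nra.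
Qed.

(** By [cosh_ge], [x^2] is dominated by [expR x + expR (- x)], whose integral is known. *)
Let I_sqr_fin : exists2 V : R, 0 <= V & I (fun x => x ^+ 2) = V%:E.
Proof.
apply: (@I_fin _ (2 * E 1 * z)) => //; rewrite -I_cosh.
apply: I_le => //; first exact: nnmeas_add.
by move=> x; have := cosh_ge x; rewrite mulN1r mul1r; lra.
Qed.

(** The integral of [expR (t * x) + expR (- t * x)] is [2 * E t * z], and its second-order term in
    [t] carries the second moment [V]; [cosh_ge] bounds [V] above and [cosh_le] bounds it below. *)
Lemma tilted_second_moment : I (fun x => x ^+ 2) = (sg * z)%:E.
Proof.
have [V V0 IV] := I_sqr_fin; rewrite IV; congr EFin; apply/eqP.
rewrite eq_le; apply/andP; split.
  (* Integrating [cosh_ge] at [t * x] gives [V <= sg * E t * z], and [E t <= 1 + t * K] leaves the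
     slope [sg * K * z]. *)
  apply: (@le_of_slope _ _ _ (sg * K * z)) => t t0 t1.
  have : (I (fun x => (2 + t ^+ 2 * x ^+ 2)%R) <=
          I (fun x => (expR (t * x) + expR (- t * x))%R))%E.
    apply: I_le; [|exact: nnmeas_add|].
      by apply: nnmeas_add => //; apply: nnmeas_scale => //; exact: sqr_ge0.
    by move=> x; have := cosh_ge (t * x); rewrite exprMn mulNr.
  have t20 : 0 <= t ^+ 2 by exact: sqr_ge0.
  rewrite I_cosh I_add//; last exact: nnmeas_scale.
  rewrite I_scale// IV.
  have -> : (fun _ : R => 2 : R) = (fun x => 2 * (fun=> 1) x).
    by apply/funext => x; rewrite mulr1.
  rewrite I_scale// I_one -!EFinM -EFinD lee_fin => h.
  have {}h : t ^+ 2 * V <= 2 * (E t - 1) * z by lra.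
  have EE : E t - 1 <= t ^+ 2 * sg / 2 * E t.
    have := @expR_le_affine _ (t ^+ 2 * sg / 2) (t ^+ 2 * sg / 2).
    rewrite lexx andbT -/(E t) => H.
    have : 0 <= t ^+ 2 * sg / 2 by rewrite divr_ge0// mulr_ge0.
    by move=> /H; lra.
  have {}h : t ^+ 2 * V <= t ^+ 2 * (sg * E t * z).
    apply: (le_trans h).
    have := ler_wpM2r z_ge0 EE; lra.
  rewrite ler_pM2l ?exprn_gt0// in h.
  apply: (le_trans h).
  have := ler_wpM2r z_ge0 (ler_wpM2l sg_ge0 (E_le1 t0 t1)); lra.
(* The slope bounds the first-order part of [(1 + t * K) * (V + t * (sg ^+ 2 * z))], using
   [t * K <= K] on the last product. *)
apply: (@le_of_slope _ _ _ (K * V + (1 + K) * (sg ^+ 2 * z))) => t t0 t1.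
have t20 : 0 <= t ^+ 2 by exact: sqr_ge0.
have t2g : 0 < t ^+ 2 by exact: exprn_gt0.
pose A (s x : R) : R := x ^+ 2 * expR (s * x).
have nA s : nnmeas (A s) by exact: nnmeas_mul.
(* Adding the tilts by [t] and [- t] cancels the cross term linear in [x], whose integral is not yet
   known. *)
have IA : (I (A t) + I (A (- t)%R) = (2 * E t * (V + (t * sg) ^+ 2 * z))%:E)%E.
  rewrite !tilt// sqrrN -/(E t) -ge0_muleDr; [|exact: I_ge0 (nnmeas_sqr _)..].
  rewrite -I_add//.
  have -> : (fun x => (x + t * sg) ^+ 2 + (x + - t * sg) ^+ 2) =
      (fun x => 2 * x ^+ 2 + 2 * (t * sg) ^+ 2 * (fun=> 1) x).
    by apply/funext => x; ring.
  have c0 : 0 <= 2 * (t * sg) ^+ 2 by rewrite mulr_ge0// sqr_ge0.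
  rewrite I_add; [|exact: nnmeas_scale|exact: nnmeas_scale].
  rewrite !I_scale// IV I_one -EFinM; congr EFin; ring.
have nB : nnmeas (fun x => t ^+ 2 / 2 * (A t x + A (- t) x)).
  by apply: nnmeas_scale; [rewrite divr_ge0|exact: nnmeas_add].
have : (I (fun x => (expR (t * x) + expR (- t * x))%R) <=
        I (fun x => (2 + t ^+ 2 / 2 * (A t x + A (- t) x))%R))%E.
  apply: I_le; [exact: nnmeas_add|exact: nnmeas_add|].
  move=> x; have := cosh_le (t * x); rewrite exprMn -mulNr /A; lra.
rewrite I_cosh I_add// I_scale//; [|by rewrite divr_ge0|exact: nnmeas_add].
rewrite I_add// IA.
have -> : (fun _ : R => 2 : R) = (fun x => 2 * (fun=> 1) x).
  by apply/funext => x; rewrite mulr1.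
rewrite I_scale// I_one -!EFinM -EFinD lee_fin => h.
set W := V + (t * sg) ^+ 2 * z in h.
(* The lower bound [1 + t ^+ 2 * sg / 2 <= E t] extracts [sg * z] from [h]. *)
have h2 : t ^+ 2 * (sg * z) <= t ^+ 2 * (E t * W).
  have := ler_wpM2r z_ge0 (E_ge t); lra.
rewrite ler_pM2l// in h2; apply: (le_trans h2).
have W0 : 0 <= W by rewrite addr_ge0// mulr_ge0// sqr_ge0.
apply: (le_trans (ler_wpM2r W0 (E_le1 t0 t1))).
have t2t : t ^+ 2 <= t by nra.
have s0 : 0 <= sg ^+ 2 * z by rewrite mulr_ge0// sqr_ge0.
have WV : W <= V + t * (sg ^+ 2 * z).
  by rewrite /W lerD2l exprMn -mulrA ler_wpM2r.
have tK : 0 <= t * K by rewrite mulr_ge0// ltW.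
have tK1 : t * K <= K by nra.
have : (1 + t * K) * W <= (1 + t * K) * (V + t * (sg ^+ 2 * z)).
  by rewrite ler_wpM2l//; lra.
have : t * K * (t * (sg ^+ 2 * z)) <= K * (t * (sg ^+ 2 * z)).
  by rewrite ler_wpM2r// mulr_ge0// ltW.
lra.
Qed.

(** Since [I] is controlled only on nonnegative functions, mean zero is phrased as equality of the
    two parts, with a common finite value. It follows from [1 + t x <= expR (t x)] for both signs of
    [t], as [E t - 1] is of order [t^2]. *)
Lemma tilted_first_moment :
  exists2 P : R, I (fun x => Num.max x 0) = P%:E &
                 I (fun x => Num.max (- x) 0) = P%:E.
Proof.
have bnd f : nnmeas f -> (forall x, f x <= 1 + x ^+ 2) ->
    exists2 q : R, 0 <= q & I f = q%:E.
  move=> nf fle; apply: (@I_fin _ (z + sg * z)) => //.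
  rewrite EFinD -I_one -tilted_second_moment -I_add//.
  by apply: I_le => //; exact: nnmeas_add.
have [P P0 IP] : exists2 q : R, 0 <= q & I (fun x => Num.max x 0) = q%:E.
  by apply: bnd => // x; rewrite ge_max; apply/andP; split; nra.
have [N N0 IN] : exists2 q : R, 0 <= q & I (fun x => Num.max (- x) 0) = q%:E.
  by apply: bnd => // x; rewrite ge_max; apply/andP; split; nra.
have maxE (x : R) : Num.max x 0 - Num.max (- x) 0 = x.
  by case: (leP x 0) => h; case: (leP (- x) 0) => h'; lra.
suff NP : N = P by exists P => //; rewrite -NP.
apply/eqP; rewrite eq_le; apply/andP; split;
    apply: (@le_of_slope _ _ _ (K * z)) => t t0 t1; have t0' := ltW t0.
(* The bound [1 - t x <= expR (- t x)], with the parts of [x] moved to the sides where they are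
   nonnegative. *)
- have : (I (fun x => (1 + t * Num.max (- x) 0)%R) <=
          I (fun x => (expR (- t * x) + t * Num.max x 0)%R))%E.
    apply: I_le; [by apply: nnmeas_add => //; apply: nnmeas_scale
                 |by apply: nnmeas_add => //; apply: nnmeas_scale|].
    by move=> x; have := expR_ge1Dx (- t * x); have := maxE x; nra.
  rewrite !I_add//; [|by apply: nnmeas_scale..].
  rewrite I_exp !I_scale// I_one IP IN -!EFinM -!EFinD lee_fin /E sqrrN -/(E t).
  have := ler_wpM2r z_ge0 (E_le t0 t1) => h1 h2.
  have : t * N <= t * (P + t * (K * z)) by lra.
  by rewrite ler_pM2l.
- have : (I (fun x => (1 + t * Num.max x 0)%R) <=
          I (fun x => (expR (t * x) + t * Num.max (- x) 0)%R))%E.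
    apply: I_le; [by apply: nnmeas_add => //; apply: nnmeas_scale
                 |by apply: nnmeas_add => //; apply: nnmeas_scale|].
    by move=> x; have := expR_ge1Dx (t * x); have := maxE x; nra.
  rewrite !I_add//; [|by apply: nnmeas_scale..].
  rewrite I_exp !I_scale// I_one IP IN -!EFinM -!EFinD lee_fin.
  have := ler_wpM2r z_ge0 (E_le t0 t1) => h1 h2.
  have : t * P <= t * (N + t * (K * z)) by lra.
  by rewrite ler_pM2l.
Qed.

End TiltedMoments.

(** * Moments of a linear statistic under a density on vectors *)

Section LintMoments.
Set Implicit Arguments.
Unset Strict Implicit.
Variables (R : realType) (k : nat) (D x : 'rV[R]_k -> R) (w : 'rV[R]_k) (sg : R).
Hypothesis mD : jmeasurable (fun _ : unit => D).
Hypothesis mx : jmeasurable (fun _ : unit => x).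
Hypothesis D_ge0 : forall v, 0 <= D v.
Hypothesis D_fin : (lint (fun v => (D v)%:E) < +oo)%E.
Hypothesis sg_ge0 : 0 <= sg.
Hypothesis D_tilt : forall (t : R) v,
  D v * expR (t * x v) = expR (t ^+ 2 * sg / 2) * D (v - t *: w).
Hypothesis x_shift : forall (t : R) v, x (v + t *: w) = x v + t * sg.

Let I (phi : R -> R) := lint (fun v => (phi (x v) * D v)%:E).

Let mI phi u : nnmeas phi -> rV_measurable (fun v => (phi (x v) * D (v - u))%:E).
Proof.
move=> [mphi phi0] d1 T1 t v mt mv; apply/measurable_EFinP.
apply: measurable_funM.
  by apply: (measurableT_comp mphi); apply: (mx (t := t)).
apply: (mD (t := t)) => // i.
under eq_fun do rewrite !mxE.
by apply: measurable_funD => //; exact: measurable_cst.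
Qed.

Let mI0 phi : nnmeas phi -> rV_measurable (fun v => (phi (x v) * D v)%:E).
Proof.
by move=> /(@mI _ 0); congr rV_measurable; apply/funext => v; rewrite subr0.
Qed.

Let I_pos phi u : nnmeas phi -> forall v, (0 <= (phi (x v) * D (v - u))%:E)%E.
Proof. by move=> [_ phi0] v; rewrite lee_fin mulr_ge0. Qed.

Let I_pos0 phi : nnmeas phi -> forall v, (0 <= (phi (x v) * D v)%:E)%E.
Proof. by move=> [_ phi0] v; rewrite lee_fin mulr_ge0. Qed.

Let I_add f g : nnmeas f -> nnmeas g ->
  (I (fun x => (f x + g x)%R) = I f + I g)%E.
Proof.
move=> nf ng; rewrite /I -lintD;
  [|exact: mI0|exact: mI0|exact: I_pos0|exact: I_pos0].
by congr lint; apply/funext => v; rewrite mulrDl EFinD.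
Qed.

Let I_scale (r : R) f : 0 <= r -> nnmeas f ->
  (I (fun x => (r * f x)%R) = r%:E * I f)%E.
Proof.
move=> r0 nf; rewrite /I -lintZ//; [|exact: mI0|exact: I_pos0].
by congr lint; apply/funext => v; rewrite -mulrA EFinM.
Qed.

Let I_le f g : nnmeas f -> nnmeas g -> (forall x, f x <= g x) -> (I f <= I g)%E.
Proof.
move=> nf ng fg; apply: le_lint; [exact: mI0|exact: mI0|exact: I_pos0|].
by move=> v; rewrite lee_fin ler_wpM2r.
Qed.

Let I_ge0 f : nnmeas f -> (0 <= I f)%E.
Proof. by move=> nf; apply: lint_ge0; exact: I_pos0. Qed.

Let I_oneE : I (fun=> 1) = lint (fun v => (D v)%:E).
Proof. by congr lint; apply/funext => v; rewrite mul1r. Qed.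

Let I_one : I (fun=> 1) = (fine (lint (fun v => (D v)%:E)))%:E.
Proof.
rewrite fineK ?I_oneE// ge0_fin_numE//; apply: lint_ge0 => v.
by rewrite lee_fin.
Qed.

(** [D_tilt] trades the exponential for a shifted density, and the substitution [v + t *: w] moves
    the shift from [D] to [x]. *)
Let I_tilt t f : nnmeas f ->
  (I (fun x => (f x * expR (t * x))%R) =
   (expR (t ^+ 2 * sg / 2))%:E * I (fun x => f (x + t * sg)%R))%E.
Proof.
move=> nf; set G := fun v => (f (x v) * D (v - t *: w))%:E.
have -> : I (fun x => f (x + t * sg)) = lint G.
  rewrite -(@lint_translation _ _ G (t *: w)); [|exact: mI|exact: I_pos].
  by congr lint; apply/funext => v; rewrite /G x_shift addrK.
rewrite -lintZ ?expR_ge0//; [|exact: mI|exact: I_pos].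
congr lint; apply/funext => v; rewrite /G -EFinM; congr EFin.
by rewrite mulrCA -D_tilt; ring.
Qed.

Lemma lint_second_moment :
  (lint (fun v => (x v ^+ 2 * D v)%:E) = sg%:E * lint (fun v => (D v)%:E))%E.
Proof.
have := tilted_second_moment I_add I_scale I_le I_ge0 I_one sg_ge0 I_tilt.
by rewrite EFinM -I_one I_oneE.
Qed.

Lemma lint_first_moment : exists2 P : R,
  lint (fun v => (Num.max (x v) 0 * D v)%:E) = P%:E &
  lint (fun v => (Num.max (- x v) 0 * D v)%:E) = P%:E.
Proof.
exact: (tilted_first_moment I_add I_scale I_le I_ge0 I_one sg_ge0 I_tilt).
Qed.

End LintMoments.

(** * Algebra of the restricted regression density *)

Section Model.
Set Implicit Arguments.
Unset Strict Implicit.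
Variable R : realType.

Lemma trmx_mul_self N (v : 'cV[R]_N) :
  (v^T *m v) 0 0 = \sum_(i < N) v i 0 ^+ 2.
Proof. by rewrite mxE; apply: eq_bigr => i _; rewrite mxE expr2. Qed.

Lemma trmx_mul_self_ge0 N (v : 'cV[R]_N) : 0 <= (v^T *m v) 0 0.
Proof. by rewrite trmx_mul_self sumr_ge0// => i _; exact: sqr_ge0. Qed.

Lemma trmx_mul_self_eq0 N (v : 'cV[R]_N) : v^T *m v = 0 -> v = 0.
Proof.
move=> /(congr1 (fun A : 'M[R]_1 => A 0 0)); rewrite trmx_mul_self [RHS]mxE => /eqP.
rewrite psumr_eq0; last by move=> i _; exact: sqr_ge0.
move=> /allP v0; apply/matrixP => i j; rewrite ord1 [RHS]mxE; apply/eqP.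
by have := v0 i; rewrite mem_index_enum => /(_ isT); rewrite sqrf_eq0.
Qed.

(** A row [u] killed by the Gram matrix makes the squared norm of [X *m u^T] vanish, and full column
    rank then forces [u = 0]. *)
Lemma gram_unitmx N p (X : 'M[R]_(N, p)) :
  \rank X = p -> X^T *m X \in unitmx.
Proof.
move=> rX; rewrite -row_free_unit; apply: inj_row_free => u uM0.
have : (X *m u^T)^T *m (X *m u^T) = 0.
  by rewrite trmx_mul trmxK mulmxA -(mulmxA u) uM0 mul0mx.
move=> /trmx_mul_self_eq0/(congr1 trmx); rewrite trmx_mul trmxK trmx0.
move=> /eqP; rewrite mulmx_free_eq0; first by move=> /eqP.
by rewrite /row_free mxrank_tr rX.
Qed.

Lemma prod_gauss N (s : R) (f : 'I_N -> R) :
  \prod_(k < N) gauss s (f k) =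
  (Num.sqrt (2 * pi * s))^-1 ^+ N * expR (- (\sum_(k < N) f k ^+ 2) / (2 * s)).
Proof.
rewrite /gauss big_split /= prodr_const card_ord -expR_sum; congr (_ * expR _).
by rewrite mulNr mulr_suml -sumrN; apply: eq_bigr => k _; rewrite mulNr.
Qed.

Lemma gauss_ge0 (s x : R) : 0 <= gauss s x.
Proof. by rewrite mulr_ge0 ?expR_ge0// invr_ge0 sqrtr_ge0. Qed.

Variables (n p : nat) (X : 'M[R]_(n * n, p)) (y : 'cV[R]_(n * n)).
Implicit Types (s : R * R * R) (th : 'rV[R]_(p + (n + n))).

Lemma rnr_dens_ge0 s th : 0 <= rnr_dens X y s th.
Proof.
by rewrite !mulr_ge0// prodr_ge0// => i _; exact: gauss_ge0.
Qed.

Hypothesis rankX : \rank X = p.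
Let Minv := invmx (X^T *m X).
Let bhat := Minv *m X^T *m y.

Definition resid th : 'cV[R]_(n * n) :=
  y - (X *m (th_delta th)^T + (1%:M - projX X) *m sender_mx R n *m (th_a th)^T
       + (1%:M - projX X) *m receiver_mx R n *m (th_b th)^T).

Definition shift_delta (w : 'rV[R]_p) : 'rV[R]_(p + (n + n)) := row_mx w 0.

Lemma th_delta_shift th w : th_delta (th + shift_delta w) = th_delta th + w.
Proof.
by rewrite /th_delta raddfD /= row_mxKl.
Qed.

Lemma th_a_shift th w : th_a (th + shift_delta w) = th_a th.
Proof.
by rewrite /th_a !raddfD /= row_mxKr raddf0 addr0.
Qed.

Lemma th_b_shift th w : th_b (th + shift_delta w) = th_b th.
Proof.
by rewrite /th_b !raddfD /= row_mxKr raddf0 addr0.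
Qed.

Lemma resid_shift th w : resid (th + shift_delta w) = resid th - X *m w^T.
Proof.
rewrite /resid th_delta_shift th_a_shift th_b_shift [(_ + w)^T]raddfD /= mulmxDr.
rewrite -[RHS]addrA -opprD; congr (_ - _).
by rewrite -!addrA; congr (_ + _); rewrite addrC -!addrA.
Qed.

Lemma Minv_sym : Minv^T = Minv.
Proof. by rewrite /Minv trmx_inv trmx_mul trmxK. Qed.

(* The projection makes the random effects orthogonal to the columns of [X]. *)
Lemma trmx_mul_resid th : X^T *m resid th = X^T *m X *m (bhat - (th_delta th)^T).
Proof.
have Q0 : X^T *m (1%:M - projX X) = 0.
  rewrite mulmxBr mulmx1 /projX !mulmxA mulmxV ?gram_unitmx//.
  by rewrite mul1mx subrr.
rewrite [RHS]mulmxBr /bhat /Minv !mulmxA mulmxV ?gram_unitmx// mul1mx.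
by rewrite /resid mulmxBr !mulmxDr !mulmxA Q0 !mul0mx !addr0.
Qed.

(** Isolates the residual, the only place where [delta] enters; the factors for [a] and [b] stay as
    they are, being invariant under the shift. *)
Lemma rnr_densE s th : rnr_dens X y s th =
  (\prod_(i < n) gauss (s_a s) (th_a th 0 i)) *
  (\prod_(i < n) gauss (s_b s) (th_b th 0 i)) *
  ((Num.sqrt (2 * pi * s_e s))^-1 ^+ (n * n) *
   expR (- ((resid th)^T *m resid th) 0 0 / (2 * s_e s))).
Proof.
rewrite trmx_mul_self -prod_gauss /rnr_dens; congr (_ * _).
by apply: eq_bigr => k _; rewrite /resid !mxE.
Qed.

Definition lin_delta (c : 'cV[R]_p) th : R := ((th_delta th - bhat^T) *m c) 0 0.
Definition qform (c : 'cV[R]_p) : R := (c^T *m Minv *m c) 0 0.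

(** Exhibits [qform c] as a squared norm: this gives its sign and the quadratic term of the tilt. *)
Lemma qform_gram (c : 'cV[R]_p) :
  (X *m (Minv *m c))^T *m (X *m (Minv *m c)) = c^T *m Minv *m c.
Proof.
rewrite !trmx_mul Minv_sym !mulmxA; congr (_ *m _).
by rewrite -!mulmxA (mulmxA X^T) mulmxV ?gram_unitmx// mulmx1.
Qed.

Lemma qform_ge0 c : 0 <= qform c.
Proof. by rewrite /qform -qform_gram trmx_mul_self_ge0. Qed.

(** Polarisation of the symmetric form [Minv]; one expansion in a scalar [e] serves both signs. *)
Lemma qform_polar (i j : 'I_p) :
  qform (delta_mx i 0 + delta_mx j 0) - qform (delta_mx i 0 - delta_mx j 0) =
  4 * Minv i j.
Proof.
pose B (a b : 'I_p) :=
  ((delta_mx a 0 : 'cV[R]_p)^T *m Minv *m (delta_mx b 0 : 'cV[R]_p)) 0 0.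
have BE a b : B a b = Minv a b by rewrite /B trmx_delta -rowE -colE !mxE.
have qE (e : R) : qform (delta_mx i 0 + e *: delta_mx j 0) =
    B i i + e * B i j + e * B j i + e ^+ 2 * B j j.
  rewrite /qform [(_ + _)^T]raddfD /= [(e *: _)^T]linearZ /=.
  rewrite !mulmxDl !mulmxDr -!scalemxAl -!scalemxAr.
  have addE (F G : 'M[R]_1) : (F + G) 0 0 = F 0 0 + G 0 0 by rewrite mxE.
  have scaleE a (F : 'M[R]_1) : (a *: F) 0 0 = a * F 0 0 by rewrite mxE.
  by rewrite !addE !scaleE !addrA mulrA expr2.
have symM : Minv j i = Minv i j by rewrite -[in LHS]Minv_sym mxE.
have := qE 1; have := qE (-1); rewrite scale1r scaleN1r => -> ->.
by rewrite !BE symM; ring.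
Qed.

(** The scaling by [s_e s] cancels the [s_e s] in the Gaussian exponent, so the cross term of the
    shifted square is exactly [t * lin_delta c th]. *)
Let dir s (c : 'cV[R]_p) := shift_delta (s_e s *: (Minv *m c)^T).

Lemma lin_delta_shift s c (t : R) th :
  lin_delta c (th + t *: dir s c) = lin_delta c th + t * (s_e s * qform c).
Proof.
have -> : t *: dir s c = shift_delta (t *: (s_e s *: (Minv *m c)^T)).
  by rewrite /dir /shift_delta scale_row_mx scaler0.
rewrite /lin_delta th_delta_shift addrAC mulmxDl mxE; congr (_ + _).
by rewrite -!scalemxAl mxE [in X in t * X]mxE trmx_mul Minv_sym.
Qed.

Lemma rnr_dens_tilt s c (t : R) th : 0 < s_e s ->
  rnr_dens X y s th * expR (t * lin_delta c th) =
  expR (t ^+ 2 * (s_e s * qform c) / 2) * rnr_dens X y s (th - t *: dir s c).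
Proof.
move=> s0.
have -> : - (t *: dir s c) = shift_delta (- (t * s_e s) *: (Minv *m c)^T).
  by rewrite /dir /shift_delta scale_row_mx opp_row_mx scaler0 oppr0 scalerA scaleNr.
rewrite !rnr_densE th_a_shift th_b_shift resid_shift.
set A := \prod_(i < n) _; set B := \prod_(i < n) _; set C := _ ^+ (n * n).
set r := resid th; set q := X *m (Minv *m c).
have -> : X *m (- (t * s_e s) *: (Minv *m c)^T)^T = - (t * s_e s) *: q.
  by rewrite linearZ /= trmxK -scalemxAr.
(* By the normal equations, [r^T *m X] depends on [th] only through [delta]: the random effects
   leave the cross term here. *)
have rq : (r^T *m q) 0 0 = - lin_delta c th.
  have rX : r^T *m X = (bhat - (th_delta th)^T)^T *m (X^T *m X).
    rewrite -[LHS]trmxK trmx_mul trmxK trmx_mul_resid trmx_mul.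
    by rewrite [(X^T *m X)^T]trmx_mul trmxK.
  rewrite /q mulmxA rX -mulmxA (mulmxA (X^T *m X)) mulmxV ?gram_unitmx// mul1mx.
  have oppE (F : 'M[R]_1) : (- F) 0 0 = - F 0 0 by rewrite mxE.
  rewrite /lin_delta -oppE -mulNmx opprB; congr ((_ *m _) _ _).
  by rewrite raddfB /= trmxK.
have qr : (q^T *m r) 0 0 = - lin_delta c th.
  by rewrite -rq -[q^T *m r]trmxK trmx_mul trmxK mxE.
have qq : (q^T *m q) 0 0 = qform c by rewrite qform_gram.
clearbody r q.
have -> : ((r - - (t * s_e s) *: q)^T *m (r - - (t * s_e s) *: q)) 0 0 =
  (r^T *m r) 0 0 - 2 * (t * s_e s) * lin_delta c th
  + (t * s_e s) ^+ 2 * qform c.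
  rewrite scaleNr opprK [(r + _)^T]raddfD /= [(_ *: q)^T]linearZ /=.
  rewrite mulmxDl !mulmxDr.
  rewrite -!scalemxAl -!scalemxAr.
  have addE (F G : 'M[R]_1) : (F + G) 0 0 = F 0 0 + G 0 0 by rewrite mxE.
  have scaleE a (F : 'M[R]_1) : (a *: F) 0 0 = a * F 0 0 by rewrite mxE.
  by rewrite !addE !scaleE rq qr qq; ring.
rewrite [RHS]mulrCA [in RHS](mulrCA (expR _)) -[LHS]mulrA -(mulrA C).
congr (_ * (_ * _)).
by rewrite -!expRD; congr expR; field; lra.
Qed.
End Model.

(** * Joint measurability in the variances and the parameter vector *)

Section JointMeasurability.
Set Implicit Arguments.
Unset Strict Implicit.
Variable R : realType.

Lemma measurable_gauss d (T : measurableType d) (a b : T -> R) :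
  measurable_fun [set: T] a -> measurable_fun [set: T] b ->
  measurable_fun [set: T] (fun t => gauss (a t) (b t)).
Proof.
move=> ma mb; rewrite /gauss; apply: measurable_funM.
  apply: (measurableT_comp (measurable_invr R)).
  apply: (measurableT_comp (measurable_sqrtr R)).
  by apply: measurable_funM => //; exact: measurable_cst.
apply: measurableT_comp => //; apply: measurable_funM.
  by apply: measurable_funN; exact: measurable_funX.
apply: (measurableT_comp (measurable_invr R)).
by apply: measurable_funM => //; exact: measurable_cst.
Qed.

Lemma measurable_lsubmx d (T : measurableType d) k l (v : T -> 'rV[R]_(k + l)) :
  measurable_rV v -> measurable_rV (fun t => lsubmx (v t)).
Proof. by move=> mv i; under eq_fun do rewrite mxE; exact: mv. Qed.

Lemma measurable_rsubmx d (T : measurableType d) k l (v : T -> 'rV[R]_(k + l)) :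
  measurable_rV v -> measurable_rV (fun t => rsubmx (v t)).
Proof. by move=> mv i; under eq_fun do rewrite mxE; exact: mv. Qed.

Lemma measurable_mulmx_tr d (T : measurableType d) m k (C : 'M[R]_(m, k))
    (v : T -> 'rV[R]_k) i :
  measurable_rV v -> measurable_fun [set: T] (fun t => (C *m (v t)^T) i 0).
Proof.
move=> mv; under eq_fun do rewrite mxE; apply: measurable_sum => j.
under eq_fun do rewrite mxE.
by apply: measurable_funM => //; exact: measurable_cst.
Qed.

Section Combinators.
Context {d : measure_display} {T : measurableType d} {k : nat}.
Implicit Types f g : T -> 'rV[R]_k -> R.

Lemma jmeasurable_fst (h : T -> R) : measurable_fun [set: T] h ->
  jmeasurable (fun t (_ : 'rV[R]_k) => h t).
Proof. by move=> mh d1 T1 t v mt mv; exact: measurableT_comp. Qed.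

Lemma jmeasurable_cst (r : R) : jmeasurable (fun (_ : T) (_ : 'rV[R]_k) => r).
Proof. by apply: jmeasurable_fst; exact: measurable_cst. Qed.

Lemma jmeasurableD f g : jmeasurable f -> jmeasurable g ->
  jmeasurable (fun t v => f t v + g t v).
Proof.
by move=> mf mg d1 T1 t v mt mv; apply: measurable_funD; [exact: mf|exact: mg].
Qed.

Lemma jmeasurableM f g : jmeasurable f -> jmeasurable g ->
  jmeasurable (fun t v => f t v * g t v).
Proof.
by move=> mf mg d1 T1 t v mt mv; apply: measurable_funM; [exact: mf|exact: mg].
Qed.

Lemma jmeasurableN f : jmeasurable f -> jmeasurable (fun t v => - f t v).
Proof. by move=> mf d1 T1 t v mt mv; apply: measurable_funN; exact: mf. Qed.

Lemma jmeasurable_max f g : jmeasurable f -> jmeasurable g ->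
  jmeasurable (fun t v => Num.max (f t v) (g t v)).
Proof.
by move=> mf mg d1 T1 t v mt mv; apply: measurable_maxr; [exact: mf|exact: mg].
Qed.

Lemma jmeasurable_EFin f : jmeasurable f -> jmeasurable (fun t v => (f t v)%:E).
Proof. by move=> mf d1 T1 t v mt mv; apply/measurable_EFinP; exact: mf. Qed.

End Combinators.

Lemma jmeasurable_rnr_dens n p (X : 'M[R]_(n * n, p)) (y : 'cV[R]_(n * n)) :
  jmeasurable (rnr_dens X y).
Proof.
move=> d1 T1 t v mt mv.
have mva : measurable_rV (fun x => th_a (v x)).
  by apply: measurable_lsubmx; exact: measurable_rsubmx.
have mvb : measurable_rV (fun x => th_b (v x)).
  by apply: measurable_rsubmx; exact: measurable_rsubmx.
have mvd : measurable_rV (fun x => th_delta (v x)) by exact: measurable_lsubmx.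
have mt1 : measurable_fun [set: T1] (fst \o t) by exact: measurableT_comp.
rewrite /rnr_dens; apply: measurable_funM; first apply: measurable_funM.
- apply: measurable_prod => i _; apply: measurable_gauss => //.
  exact: (measurableT_comp measurable_fst mt1).
- apply: measurable_prod => i _; apply: measurable_gauss => //.
  exact: (measurableT_comp measurable_snd mt1).
- apply: measurable_prod => i _; apply: measurable_gauss.
    exact: (measurableT_comp measurable_snd mt).
  apply: measurable_funB; first exact: measurable_cst.
  under eq_fun do rewrite 2!mxE.
  apply: measurable_funD; first apply: measurable_funD.
  + exact: measurable_mulmx_tr.
  + exact: measurable_mulmx_tr.
  + exact: measurable_mulmx_tr.
Qed.

Lemma jmeasurable_lin_delta d (T : measurableType d) n p
    (X : 'M[R]_(n * n, p)) (y : 'cV[R]_(n * n)) c :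
  jmeasurable (fun (_ : T) => lin_delta X y c).
Proof.
move=> d1 T1 t v mt mv; rewrite /lin_delta.
under eq_fun do rewrite mxE; apply: measurable_sum => j.
apply: measurable_funM; last exact: measurable_cst.
under eq_fun do rewrite mxE.
apply: measurable_funD; last exact: measurable_cst.
by apply: measurable_lsubmx.
Qed.

End JointMeasurability.

(** * Integration over the prior of the variances *)

Section Posterior.
Set Implicit Arguments.
Unset Strict Implicit.
Variables (R : realType) (n p : nat) (X : 'M[R]_(n * n, p)) (y : 'cV[R]_(n * n)).
Variable nu : {measure set (R * R * R)%type -> \bar R}.
Local Notation par := (R * R * R)%type.
Local Notation vec := 'rV[R]_(p + (n + n)).
Implicit Types (s : par) (th : vec) (g h : par -> vec -> R).

Definition nnjmeas g := jmeasurable g /\ forall s th, 0 <= g s th.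

Let L g s := lint (fun th => (g s th * rnr_dens X y s th)%:E).

Let mgd g : nnjmeas g -> jmeasurable (fun s th => (g s th * rnr_dens X y s th)%:E).
Proof.
move=> [mg _]; apply: jmeasurable_EFin; apply: jmeasurableM => //.
exact: jmeasurable_rnr_dens.
Qed.

Let gd_ge0 g : nnjmeas g -> forall s th, (0 <= (g s th * rnr_dens X y s th)%:E)%E.
Proof. by move=> [_ g0] s th; rewrite lee_fin mulr_ge0// rnr_dens_ge0. Qed.

Let mL g : nnjmeas g -> measurable_fun [set: par] (L g).
Proof. by move=> ng; apply: measurable_lint; [exact: mgd|exact: gd_ge0]. Qed.

Let L_ge0 g s : nnjmeas g -> (0 <= L g s)%E.
Proof. by move=> ng; apply: lint_ge0; exact: gd_ge0. Qed.

Let mgd1 g s : nnjmeas g ->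
  rV_measurable (fun th => (g s th * rnr_dens X y s th)%:E).
Proof. by move=> ng; exact: (jmeasurable_slice s (mgd ng)). Qed.

Lemma post_intD g h : nnjmeas g -> nnjmeas h ->
  (post_int X y nu (fun s th => (g s th + h s th)%R) =
   post_int X y nu g + post_int X y nu h)%E.
Proof.
move=> ng nh; rewrite /post_int -ge0_integralD//; first last.
- exact: mL.
- by move=> s _; exact: L_ge0.
- exact: mL.
- by move=> s _; exact: L_ge0.
apply: eq_integral => s _; rewrite -lintD; [|exact: mgd1|exact: mgd1
  |exact: gd_ge0|exact: gd_ge0].
by congr lint; apply/funext => th; rewrite mulrDl.
Qed.

Lemma post_intZ (r : R) g : 0 <= r -> nnjmeas g ->
  (post_int X y nu (fun s th => (r * g s th)%R) = r%:E * post_int X y nu g)%E.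
Proof.
move=> r0 ng; rewrite /post_int -ge0_integralZl_EFin//; first last.
- exact: mL.
- by move=> s _; exact: L_ge0.
apply: eq_integral => s _; rewrite -lintZ//; [|exact: mgd1|exact: gd_ge0].
by congr lint; apply/funext => th; rewrite -mulrA EFinM.
Qed.

Lemma le_post_int g h : nnjmeas g -> nnjmeas h ->
  (forall s th, g s th <= h s th) ->
  (post_int X y nu g <= post_int X y nu h)%E.
Proof.
move=> ng nh gh; apply: ge0_le_integral => //.
- by move=> s _; exact: L_ge0.
- exact: mL.
- exact: mL.
- move=> s _; apply: le_lint; [exact: mgd1|exact: mgd1|exact: gd_ge0|].
  by move=> th; rewrite lee_fin ler_wpM2r// rnr_dens_ge0.
Qed.

Lemma post_int_ge0 g : nnjmeas g -> (0 <= post_int X y nu g)%E.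
Proof. by move=> ng; apply: integral_ge0 => s _; exact: L_ge0. Qed.

Hypothesis nu_pos :
  nu [set s | ~ (0 < s_a s /\ 0 < s_b s /\ 0 < s_e s)] = 0%E.
Hypothesis Z_fin : (post_Z X y nu < +oo)%E.

Lemma nnjmeas_cst (r : R) : 0 <= r -> nnjmeas (fun _ _ => r).
Proof. by move=> r0; split=> //; exact: jmeasurable_cst. Qed.

(** The variances at which the conditional moment identities apply. *)
Let good s := 0 < s_e s /\ (lint (fun th => (rnr_dens X y s th)%:E) < +oo)%E.

Let LE s : L (fun _ _ => 1) s = lint (fun th => (rnr_dens X y s th)%:E).
Proof. by congr lint; apply/funext => th; rewrite mul1r. Qed.

(** A finite integral [post_Z] forces the inner mass to be finite almost everywhere; positivity
    comes from [nu_pos]. *)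
Lemma ae_good : {ae nu, forall s, [set: par] s -> good s}.
Proof.
have n1 := nnjmeas_cst ler01.
have iZ : nu.-integrable [set: par] (L (fun _ _ => 1)).
  apply/integrableP; split; first exact: mL.
  rewrite (le_lt_trans _ Z_fin)// /post_Z /post_int le_eqVlt; apply/orP; left.
  by apply/eqP; apply: eq_integral => s _; rewrite gee0_abs//; exact: L_ge0.
have ae1 := integrable_ae measurableT iZ.
have mS (f : par -> R) : measurable_fun [set: par] f ->
    measurable [set s | 0 < f s].
  move=> mf; rewrite (_ : [set s | _] = [set: par] `&` f @^-1` `]0, +oo[).
    exact: mf.
  by rewrite setTI; apply/seteqP; split => s /=; rewrite in_itv/= andbT.
have ae2 : {ae nu, forall s, 0 < s_a s /\ 0 < s_b s /\ 0 < s_e s}.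
  exists [set s | ~ (0 < s_a s /\ 0 < s_b s /\ 0 < s_e s)]; split => //.
  rewrite (_ : [set _ | _] =
    ~` ([set s | 0 < s_a s] `&` ([set s | 0 < s_b s] `&` [set s | 0 < s_e s])))//.
  apply: measurableC; apply: measurableI; last apply: measurableI; apply: mS.
  - exact: (measurableT_comp measurable_fst measurable_fst).
  - exact: (measurableT_comp measurable_snd measurable_fst).
  - exact: measurable_snd.
apply: filterS2 ae1 ae2 => s /(_ I) fZ [_ [_ s0]] _; split => //.
by rewrite -LE -ge0_fin_numE//; exact: L_ge0.
Qed.

(** Lifts an identity conditional on the variances to the joint posterior. *)
Lemma eq_post_int g h : nnjmeas g -> nnjmeas h ->
  (forall s, good s -> L g s = L h s) ->
  post_int X y nu g = post_int X y nu h.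
Proof.
move=> ng nh gh; apply: ge0_ae_eq_integral => //.
- exact: mL.
- exact: mL.
- by move=> s _; exact: L_ge0.
- by move=> s _; exact: L_ge0.
- by apply: filterS ae_good => s gs _; apply: gh; exact: gs.
Qed.

Hypothesis rankX : \rank X = p.

Let mdens s : jmeasurable (fun _ : unit => rnr_dens X y s).
Proof. by apply: jmeasurable_slice; exact: jmeasurable_rnr_dens. Qed.

Let sg_ge0 s c : good s -> 0 <= s_e s * qform X c.
Proof. by move=> [s0 _]; rewrite mulr_ge0 ?qform_ge0// ltW. Qed.

Local Notation x c := (lin_delta X y c).

Lemma nnjmeas_sqr_lin c : nnjmeas (fun _ th => x c th ^+ 2).
Proof.
split=> [|s th]; last exact: sqr_ge0.
by apply: jmeasurableM; exact: jmeasurable_lin_delta.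
Qed.

Lemma nnjmeas_pos g : jmeasurable g -> nnjmeas (pos_part g).
Proof.
move=> mg; split=> [|s th]; last by rewrite /pos_part le_max lexx orbT.
by apply: jmeasurable_max => //; exact: jmeasurable_cst.
Qed.

Lemma nnjmeas_neg g : jmeasurable g -> nnjmeas (neg_part g).
Proof.
move=> mg; split=> [|s th]; last by rewrite /neg_part le_max lexx orbT.
by apply: jmeasurable_max; [exact: jmeasurableN|exact: jmeasurable_cst].
Qed.

Lemma nnjmeasD g h : nnjmeas g -> nnjmeas h ->
  nnjmeas (fun s th => g s th + h s th).
Proof.
by move=> [mg g0] [mh h0]; split=> [|s th]; [exact: jmeasurableD|exact: addr_ge0].
Qed.

Lemma nnjmeasZ (r : R) g : 0 <= r -> nnjmeas g ->
  nnjmeas (fun s th => r * g s th).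
Proof.
move=> r0 [mg g0]; split=> [|s th]; last exact: mulr_ge0.
by apply: jmeasurableM => //; exact: jmeasurable_cst.
Qed.

Lemma jmeasurable_s_e : jmeasurable (fun s (_ : vec) => s_e s).
Proof. by apply: jmeasurable_fst; exact: measurable_snd. Qed.

Lemma post_int_lin_pos_neg c :
  post_int X y nu (pos_part (fun _ => x c)) =
  post_int X y nu (neg_part (fun _ => x c)).
Proof.
have mx := @jmeasurable_lin_delta R _ par n p X y c.
apply: eq_post_int; [exact: nnjmeas_pos|exact: nnjmeas_neg|] => s gs.
have [s0 Zs] := gs.
have [P P1 P2] := @lint_first_moment R _ (rnr_dens X y s) (x c) _ _ (mdens s)
  (jmeasurable_lin_delta X y c) (rnr_dens_ge0 X y s) Zs (sg_ge0 c gs)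
  (fun t th => rnr_dens_tilt y rankX c t th s0)
  (fun t th => lin_delta_shift X y s c t th).
by rewrite /L /pos_part /neg_part P1 P2.
Qed.

Lemma post_int_lin_sqr c :
  (post_int X y nu (fun _ th => (x c th ^+ 2)%R) =
   (qform X c)%:E * post_int X y nu (pos_part (fun s _ => s_e s)))%E.
Proof.
have ns := nnjmeas_pos jmeasurable_s_e.
rewrite -post_intZ//; last exact: qform_ge0.
apply: eq_post_int; first exact: nnjmeas_sqr_lin.
  by apply: nnjmeasZ => //; exact: qform_ge0.
move=> s gs; have [s0 Zs] := gs.
rewrite /L (@lint_second_moment R _ (rnr_dens X y s) (x c) _ _ (mdens s)
  (jmeasurable_lin_delta X y c) (rnr_dens_ge0 X y s) Zs (sg_ge0 c gs)
  (fun t th => rnr_dens_tilt y rankX c t th s0)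
  (fun t th => lin_delta_shift X y s c t th)).
rewrite -lintZ; [|exact: jmeasurable_EFin
  |by move=> v; rewrite lee_fin rnr_dens_ge0|exact: sg_ge0].
(* At good variances [s_e s] is positive, hence equal to its positive part, the form in which
   [postE] integrates it. *)
congr lint; apply/funext => th; rewrite -EFinM /pos_part max_l ?(ltW s0)//.
by rewrite (mulrC (s_e s)).
Qed.

Lemma post_int_s_e_neg : post_int X y nu (neg_part (fun s _ => s_e s)) = 0%E.
Proof.
(* Zero is recast as an integral so that the comparison at good variances applies. *)
have -> : 0%E = post_int X y nu (fun s th => 0 * (fun _ _ => 1) s th).
  by rewrite post_intZ ?mul0e//; exact: nnjmeas_cst.
apply: eq_post_int.
- exact/nnjmeas_neg/jmeasurable_s_e.
- by apply: nnjmeasZ => //; exact: nnjmeas_cst.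
move=> s [s0 _]; congr lint; apply/funext => th; rewrite /neg_part mul0r max_r//.
by rewrite oppr_le0 ltW.
Qed.

End Posterior.

(** * Signed integrands through positive and negative parts *)

Section SignedMoments.
Set Implicit Arguments.
Unset Strict Implicit.
Variables (R : realType) (n p : nat).
Local Notation par := (R * R * R)%type.
Local Notation vec := 'rV[R]_(p + (n + n)).
Implicit Types (s : par) (th : vec) (g h u v : par -> vec -> R).

(** [J] abstracts [post_int]. It is additive on nonnegative integrands, so signed identities are
    arranged to have nonnegative terms on both sides. *)
Variables (J : (par -> vec -> R) -> \bar R) (z : R).
Hypothesis JD : forall g h, nnjmeas g -> nnjmeas h ->
  (J (fun s th => (g s th + h s th)%R) = J g + J h)%E.
Hypothesis JZ : forall (r : R) g, 0 <= r -> nnjmeas g ->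
  (J (fun s th => (r * g s th)%R) = r%:E * J g)%E.
Hypothesis J_le : forall g h, nnjmeas g -> nnjmeas h ->
  (forall s th, g s th <= h s th) -> (J g <= J h)%E.
Hypothesis J_ge0 : forall g, nnjmeas g -> (0 <= J g)%E.
Hypothesis J_one : J (fun _ _ => 1) = z%:E.

Let J_cst (r : R) : 0 <= r -> J (fun _ _ => r) = (r * z)%:E.
Proof.
move=> r0; rewrite EFinM -J_one -JZ//; last exact: nnjmeas_cst.
by congr J; apply/funext => s; apply/funext => th; rewrite mulr1.
Qed.

Let J_fin g (r : R) : nnjmeas g -> (J g <= r%:E)%E -> exists q : R, J g = q%:E.
Proof.
move=> ng; have := J_ge0 ng; case: (J g) => [q _ _|_|//]; last by rewrite leye_eq.
by exists q.
Qed.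

Let max_split (a : R) : Num.max a 0 = a + Num.max (- a) 0.
Proof. by case: (leP a 0) => h; case: (leP (- a) 0) => h'; lra. Qed.

Let max0_ge0 (a : R) : 0 <= Num.max a 0.
Proof. by rewrite le_max lexx orbT. Qed.

Definition sqr_fun u : par -> vec -> R := fun s th => u s th ^+ 2.

Let nnsqr u : jmeasurable u -> nnjmeas (sqr_fun u).
Proof.
by move=> mu; split=> [|s th]; [exact: jmeasurableM|exact: sqr_ge0].
Qed.

(** Adds a constant [b] to a centred statistic [u]; the finite second moment [q] makes every part
    finite, so that the parts may be subtracted. *)
Lemma signed_mean u (b q : R) : jmeasurable u ->
  J (pos_part u) = J (neg_part u) -> J (sqr_fun u) = q%:E ->
  exists P N : R, [/\ J (pos_part (fun s th => u s th + b)) = P%:E,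
    J (neg_part (fun s th => u s th + b)) = N%:E & P - N = b * z].
Proof.
move=> mu Euu Jq; set dl := fun s th => u s th + b.
have md : jmeasurable dl by apply: jmeasurableD => //; exact: jmeasurable_cst.
have b0 := normr_ge0 b; have c0 : 0 <= 1 + `|b| by rewrite addr_ge0.
have nc : nnjmeas (fun (_ : par) (_ : vec) => 1 + `|b|) by exact: nnjmeas_cst.
have bnd g : nnjmeas g -> (forall s th, g s th <= (1 + `|b|) + sqr_fun u s th) ->
    exists r : R, J g = r%:E.
  move=> ng gle; apply: (@J_fin _ ((1 + `|b|) * z + q)) => //.
  rewrite EFinD -Jq -J_cst// -JD//; last exact: nnsqr.
  by apply: J_le => //; apply: nnjmeasD => //; exact: nnsqr.
have bn := ler_norm b; have bnN := ler_norm (- b); rewrite normrN in bnN.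
have [P Fp] : exists r : R, J (pos_part dl) = r%:E.
  apply: bnd; first exact: nnjmeas_pos.
  by move=> s th; rewrite /pos_part /sqr_fun ge_max /dl; apply/andP; split; nra.
have [N Fn] : exists r : R, J (neg_part dl) = r%:E.
  apply: bnd; first exact: nnjmeas_neg.
  by move=> s th; rewrite /neg_part /sqr_fun ge_max /dl; apply/andP; split; nra.
have [Q Fu] : exists r : R, J (pos_part u) = r%:E.
  apply: bnd; first exact: nnjmeas_pos.
  by move=> s th; rewrite /pos_part /sqr_fun ge_max; apply/andP; split; nra.
exists P, N; split => //.
(* The identity [dl = u + b], with each term split into parts and the negative ones moved across. *)
have : J (fun s th => pos_part dl s th + neg_part u s th + Num.max (- b) 0) =
       J (fun s th => neg_part dl s th + pos_part u s th + Num.max b 0).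
  congr J; apply/funext => s; apply/funext => th; rewrite /pos_part /neg_part.
  by rewrite (max_split (dl s th)) (max_split (u s th)) (max_split b) /dl; ring.
have np := nnjmeas_pos md; have nn := nnjmeas_neg md.
have nup := nnjmeas_pos mu; have nun := nnjmeas_neg mu.
rewrite JD; [|exact: nnjmeasD|exact: nnjmeas_cst].
rewrite [RHS]JD; [|exact: nnjmeasD|exact: nnjmeas_cst].
rewrite JD// [in RHS]JD// -Euu Fu Fp Fn !J_cst// -!EFinD => -[] H.
have -> : b = Num.max b 0 - Num.max (- b) 0 by rewrite (max_split b); ring.
by lra.
Qed.

(** Polarisation [u v = ((u + v)^2 - (u - v)^2) / 4]; finiteness follows from the bound of [|u v|]
    by [u^2 + v^2]. *)
Lemma signed_product u v (q1 q2 q3 q4 : R) :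
  jmeasurable u -> jmeasurable v ->
  J (sqr_fun u) = q1%:E -> J (sqr_fun v) = q2%:E ->
  J (sqr_fun (fun s th => u s th + v s th)) = q3%:E ->
  J (sqr_fun (fun s th => u s th - v s th)) = q4%:E ->
  exists P N : R, [/\ J (pos_part (fun s th => u s th * v s th)) = P%:E,
    J (neg_part (fun s th => u s th * v s th)) = N%:E & P - N = (q3 - q4) / 4].
Proof.
move=> mu mv J1 J2 J3 J4; set uv := fun s th => u s th * v s th.
have muv : jmeasurable uv by exact: jmeasurableM.
have bnd g : nnjmeas g -> (forall s th, g s th <= sqr_fun u s th + sqr_fun v s th) ->
    exists r : R, J g = r%:E.
  move=> ng gle; apply: (@J_fin _ (q1 + q2)) => //.
  rewrite EFinD -J1 -J2 -JD//; [|exact: nnsqr..].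
  by apply: J_le => //; apply: nnjmeasD; exact: nnsqr.
have sq s th := sqr_ge0 (u s th + v s th).
have sq' s th := sqr_ge0 (u s th - v s th).
have [P Fp] : exists r : R, J (pos_part uv) = r%:E.
  apply: bnd; first exact: nnjmeas_pos.
  move=> s th; rewrite /pos_part /sqr_fun ge_max /uv.
  have := sq s th; have := sq' s th; rewrite sqrrB sqrrD => ? ?.
  by apply/andP; split; lra.
have [N Fn] : exists r : R, J (neg_part uv) = r%:E.
  apply: bnd; first exact: nnjmeas_neg.
  move=> s th; rewrite /neg_part /sqr_fun ge_max /uv.
  have := sq s th; have := sq' s th; rewrite sqrrB sqrrD => ? ?.
  by apply/andP; split; lra.
exists P, N; split => //.
set a := fun s th => u s th + v s th in J3 *.
set d := fun s th => u s th - v s th in J4 *.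
have na : nnjmeas (sqr_fun a) by apply: nnsqr; exact: jmeasurableD.
have nd : nnjmeas (sqr_fun d).
  by apply: nnsqr; apply: jmeasurableD => //; exact: jmeasurableN.
have q0 : 0 <= 4^-1 :> R by rewrite invr_ge0.
(* The polarisation identity with the subtracted square moved to the left. *)
have : J (fun s th => pos_part uv s th + 4^-1 * sqr_fun d s th) =
       J (fun s th => neg_part uv s th + 4^-1 * sqr_fun a s th).
  congr J; apply/funext => s; apply/funext => th; rewrite /pos_part /neg_part.
  by rewrite (max_split (uv s th)) /sqr_fun /uv /a /d; field.
rewrite JD; [|exact: nnjmeas_pos|exact: nnjmeasZ].
rewrite [RHS]JD; [|exact: nnjmeas_neg|exact: nnjmeasZ].
rewrite JZ// JZ// J3 J4 Fp Fn -!EFinM -!EFinD => -[] H.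
by lra.
Qed.

End SignedMoments.

(** * Posterior mean and covariance of the regression effects *)

Theorem theorem1 (R : realType) (n p : nat) (X : 'M[R]_(n * n, p))
  (y : 'cV[R]_(n * n)) (nu : {measure set (R * R * R)%type -> \bar R}) :
  \rank X = p ->
  nu [set s | ~ (0 < s_a s /\ 0 < s_b s /\ 0 < s_e s)] = 0%E ->
  (0 < post_Z X y nu < +oo)%E ->
  post_integrable X y nu (fun s _ => s_e s) ->
  let bhat := invmx (X^T *m X) *m X^T *m y in
  let m i := postE X y nu (fun _ th => th_delta th 0 i) in
  (forall i : 'I_p,
     post_integrable X y nu (fun _ th => th_delta th 0 i) /\
     m i = bhat i 0) /\
  (forall i j : 'I_p,
     post_integrable X y nu
       (fun _ th => (th_delta th 0 i - m i) * (th_delta th 0 j - m j)) /\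
     postE X y nu (fun _ th => (th_delta th 0 i - m i) * (th_delta th 0 j - m j))
     = invmx (X^T *m X) i j * postE X y nu (fun s _ => s_e s)).
Proof.
move=> rankX nu_pos /andP[Z_gt0 Z_fin] [S_fin _] bhat m.
pose z := fine (post_Z X y nu).
have ZE : post_int X y nu (fun _ _ => 1) = z%:E.
  by rewrite /z fineK// ge0_fin_numE// ltW.
have z_gt0 : 0 < z by rewrite -lte_fin /z fineK// ge0_fin_numE// ltW.
pose S := fine (post_int X y nu (pos_part (fun s _ => s_e s))).
have SE : post_int X y nu (pos_part (fun s _ => s_e s)) = S%:E.
  rewrite /S fineK// ge0_fin_numE//; apply: post_int_ge0.
  by apply: nnjmeas_pos; exact: jmeasurable_s_e.
pose lin c := fun (_ : R * R * R) => lin_delta X y c.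
have mlin c : jmeasurable (lin c) by exact: jmeasurable_lin_delta.
have sqrE c : post_int X y nu (sqr_fun (lin c)) = (qform X c * S)%:E.
  by rewrite EFinM -SE; exact: post_int_lin_sqr.
(* Unit directions turn [lin_delta] into the centred coordinates of [delta]. *)
pose e i : 'cV[R]_p := delta_mx i 0.
have eE i th : lin_delta X y (e i) th = th_delta th 0 i - bhat i 0.
  by rewrite /lin_delta -colE !mxE.
have JD := @post_intD R n p X y nu; have JZ := @post_intZ R n p X y nu.
have J_le := @le_post_int R n p X y nu.
have J_ge0 := @post_int_ge0 R n p X y nu.
have mean i : post_integrable X y nu (fun _ th => th_delta th 0 i) /\
    m i = bhat i 0.
  have := signed_mean JD JZ J_le J_ge0 ZE (bhat i 0) (mlin (e i))
    (post_int_lin_pos_neg nu_pos Z_fin rankX (e i)) (sqrE (e i)).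
  have -> : (fun s th => lin (e i) s th + bhat i 0) = (fun _ th => th_delta th 0 i).
    by apply/funext => s; apply/funext => th; rewrite /lin eE subrK.
  move=> [P [N [FP FN PN]]]; split; first by rewrite /post_integrable FP FN !ltry.
  by rewrite /m /postE FP FN -/z /= PN mulfK// gt_eqF.
split=> // i j.
(* The covariance is centred at [m], now known to be [bhat], so its factors are [lin (e i)] and
   [lin (e j)]. *)
have mE : m = fun i => bhat i 0 by apply/funext => l; case: (mean l).
rewrite mE.
have add_lin c c' : (fun s th => lin c s th + lin c' s th) = lin (c + c').
  by apply/funext => s; apply/funext => th; rewrite /lin /lin_delta mulmxDr [RHS]mxE.
have sub_lin c c' : (fun s th => lin c s th - lin c' s th) = lin (c - c').
  have subE (F G : 'M[R]_1) : (F - G) 0 0 = F 0 0 - G 0 0 by rewrite !mxE.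
  by apply/funext => s; apply/funext => th; rewrite /lin /lin_delta mulmxBr subE.
have sqrD := sqrE (e i + e j); rewrite -add_lin in sqrD.
have sqrB := sqrE (e i - e j); rewrite -sub_lin in sqrB.
have := signed_product JD JZ J_le J_ge0 (mlin (e i)) (mlin (e j))
  (sqrE (e i)) (sqrE (e j)) sqrD sqrB.
have -> : (fun s th => lin (e i) s th * lin (e j) s th) =
    (fun _ th => (th_delta th 0 i - bhat i 0) * (th_delta th 0 j - bhat j 0)).
  by apply/funext => s; apply/funext => th; rewrite /lin !eE.
move=> [P [N [FP FN PN]]]; split; first by rewrite /post_integrable FP FN !ltry.
(* Both sides share the divisor [z], and the negative part of [s_e] contributes nothing;
   polarisation of [qform] then matches the numerators. *)
rewrite /postE FP FN -/z /= PN SE (post_int_s_e_neg nu_pos Z_fin) /= subr0.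
rewrite mulrA; congr (_ / _).
by rewrite -mulrBl qform_polar; field.
Qed.
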